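(* Let $N\ge 2$, $c>1$, $d>0$, and $i\in\{1,\dots,N-1\}$. Let $\alpha_1,\dots,\alpha_N>0$ and let $\beta_j\ge 0$ for $j\in\{1,\dots,N-1\}\setminus\{i\}$, with the boundary conventions $\alpha_0=\alpha_{N+1}=0$, $\beta_0=\beta_N=0$. Let $\hat\mu_j$ and $\hat\Sigma_{jj}$ be the posterior means and variances defined in the context. Then the unique positive real root $\beta_i$ of the equation $$\frac{c-1}{\beta_i}-d+\frac12\left(\frac{\alpha_{i+1}}{\alpha_i+\beta_{i-1}\alpha_{i-1}+\beta_i\alpha_{i+1}}+\frac{\alpha_i}{\alpha_{i+1}+\beta_i\alpha_i+\beta_{i+1}\alpha_{i+2}}\right)-\frac12\left[\alpha_{i+1}\left(\hat\mu_i^2+\hat\Sigma_{ii}\right)+\alpha_i\left(\hat\mu_{i+1}^2+\hat\Sigma_{i+1,i+1}\right)\right]=0$$ satisfies $$0<\beta_i<\frac{c}{d}.$$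
   Context: The equation is the first-order stationarity condition in $\beta_i$ of the EM objective for the following model. Observations $\mathbf{y}=\boldsymbol{\Phi}\mathbf{x}+\mathbf{n}$ with $\mathbf{y}\in\mathbb{R}^M$, $\boldsymbol{\Phi}\in\mathbb{R}^{M\times N}$, and Gaussian noise $\mathbf{n}\sim\mathcal{N}(0,\gamma^{-1}\mathbf{I})$. The prior on $\mathbf{x}\in\mathbb{R}^N$ has independent components $x_j\sim\mathcal{N}\big(0,(\alpha_j+\beta_{j-1}\alpha_{j-1}+\beta_j\alpha_{j+1})^{-1}\big)$. The coupling parameters $\beta_1,\dots,\beta_{N-1}$ have independent Gamma priors with shape $c$ and rate $d$, i.e. density proportional to $\beta^{c-1}e^{-d\beta}$ on $\beta>0$. For $c>1$ the equation has exactly one positive real root. The posterior moments are computed from the previous iterates, which are fixed real parameters $\bar\alpha_1,\dots,\bar\alpha_N>0$, $\bar\beta_1,\dots,\bar\beta_{N-1}\ge 0$, $\bar\gamma>0$ (with $\bar\alpha_0=\bar\alpha_{N+1}=\bar\beta_0=\bar\beta_N=0$) that do not depend on the unknown $\beta_i$: $$\hat{\boldsymbol{\Sigma}}=\left(\bar\gamma\,\boldsymbol{\Phi}^T\boldsymbol{\Phi}+\boldsymbol{\Lambda}\right)^{-1},\qquad \hat{\boldsymbol{\mu}}=\bar\gamma\,\hat{\boldsymbol{\Sigma}}\boldsymbol{\Phi}^T\mathbf{y},$$ where $\boldsymbol{\Lambda}$ is the diagonal matrix with $j$-th diagonal entry $\bar\alpha_j+\bar\beta_{j-1}\bar\alpha_{j-1}+\bar\beta_j\bar\alpha_{j+1}$.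 Here $\hat\mu_j$ is the $j$-th entry of $\hat{\boldsymbol{\mu}}$ and $\hat\Sigma_{jj}$ the $(j,j)$ entry of $\hat{\boldsymbol{\Sigma}}$. *)

(* Defs.v *)
From mathcomp Require Import all_boot all_order all_algebra.
From mathcomp Require Import reals.

Set Implicit Arguments.
Unset Strict Implicit.
Unset Printing Implicit Defensive.

Import Order.TTheory GRing.Theory Num.Theory.
Local Open Scope ring_scope.

(* The parameters alpha_0, ..., alpha_(N+1) and beta_0, ..., beta_N are
   functions nat -> R with the usual numbering from 1 (plus the boundary
   indices), whereas the coordinates of 'cV_N and 'M_N are numbered from 0:
   k : 'I_N stands for the coordinate numbered k.+1. *)

Definition prior_precision (R : realType) (alpha beta : nat -> R) (j : nat) : R :=
  alpha j + beta j.-1 * alpha j.-1 + beta j * alpha j.+1.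

Definition prior_precision_mx (R : realType) (N : nat) (alpha beta : nat -> R)
    : 'M[R]_N :=
  diag_mx (\row_(k < N) prior_precision alpha beta k.+1).

(* invmx A is A itself when A is not invertible; this does not occur for
   positive alpha and gamma and nonnegative beta, where the matrix is positive
   definite. *)
Definition posterior_cov (R : realType) (M N : nat) (Phi : 'M[R]_(M, N))
    (alpha beta : nat -> R) (gamma : R) : 'M[R]_N :=
  invmx (gamma *: (Phi^T *m Phi) + prior_precision_mx N alpha beta).

Definition posterior_mean (R : realType) (M N : nat) (Phi : 'M[R]_(M, N))
    (y : 'cV[R]_M) (alpha beta : nat -> R) (gamma : R) : 'cV[R]_N :=
  gamma *: (posterior_cov Phi alpha beta gamma *m Phi^T *m y).

(* Left-hand side of the stationarity equation at beta_i = b: the unknown b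
   replaces beta i, which does not occur. The ordinals k and l are the
   coordinates numbered i and i + 1 of mu and Sigma. *)
Definition stationarity_lhs (R : realType) (N : nat) (c d : R)
    (alpha beta : nat -> R) (mu : 'cV[R]_N) (Sigma : 'M[R]_N)
    (i : nat) (k l : 'I_N) (b : R) : R :=
  (c - 1) / b - d
  + 2^-1 * (alpha i.+1
              / (alpha i + beta i.-1 * alpha i.-1 + b * alpha i.+1)
            + alpha i
              / (alpha i.+1 + b * alpha i + beta i.+1 * alpha i.+2))
  - 2^-1 * (alpha i.+1 * (mu k 0 ^+ 2 + Sigma k k)
            + alpha i * (mu l 0 ^+ 2 + Sigma l l)).

(* Main.v *)
Require Import Defs.
From mathcomp Require Import all_boot all_order all_algebra.
From mathcomp Require Import reals.
From mathcomp Require Import ring lra zify.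

(** Write the stationarity equation as [score b = 0] with
<<
  score b = a / b - d + (A / (p + b A) + B / (q + b B)) / 2 - K / 2
>>
    where [a = c - 1], [A] and [B] are the two neighbouring values of alpha,
    [p] and [q] are the parts of the two prior precisions that do not involve
    [b], and [K] is the data term.

    The bound comes from [p, q > 0]: then [A / (p + b A) < 1 / b] and likewise
    for [B], so [score b < c / b - d - K / 2].  As soon as [K >= 0], the score
    is therefore negative at every [b >= c / d] ([score_lt0]).  The score is
    strictly decreasing on the positive axis ([score_decr]), hence has at most
    one root there.  Multiplied by its denominators it becomes a cubic whose
    value at 0 is [a p q > 0], so the intermediate value theorem for
    polynomials on [[0, c / d]] yields a root ([score_root]).

    The data enter only through [K >= 0], that is, through the nonnegativity
    of the posterior variances.  It holds because a precision matrix
    [gamma Phi^T Phi + Lambda] with nonnegative [Lambda] is positive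
    semidefinite, and inversion preserves this ([psdmx_inv]). *)

Set Implicit Arguments.
Unset Strict Implicit.
Unset Printing Implicit Defensive.

Import Order.TTheory GRing.Theory Num.Theory.
Local Open Scope ring_scope.

(** * Positive semidefinite matrices *)

Definition psdmx (R : realFieldType) (n : nat) (A : 'M[R]_n) : Prop :=
  forall v : 'cV[R]_n, 0 <= (v^T *m A *m v) 0 0.

Lemma psdmx_diag_ge0 (R : realFieldType) (n : nat) (A : 'M[R]_n) (k : 'I_n) :
  psdmx A -> 0 <= A k k.
Proof.
move=> /(_ (delta_mx k 0)).
by rewrite trmx_delta -rowE -colE !mxE.
Qed.

Lemma psdmxD (R : realFieldType) (n : nat) (A B : 'M[R]_n) :
  psdmx A -> psdmx B -> psdmx (A + B).
Proof. by move=> hA hB v; rewrite mulmxDr mulmxDl mxE addr_ge0. Qed.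

Lemma psdmxZ (R : realFieldType) (n : nat) (a : R) (A : 'M[R]_n) :
  0 <= a -> psdmx A -> psdmx (a *: A).
Proof. by move=> ha hA v; rewrite -scalemxAr -scalemxAl mxE mulr_ge0. Qed.

Lemma psdmx_gram (R : realFieldType) (m n : nat) (B : 'M[R]_(m, n)) :
  psdmx (B^T *m B).
Proof.
move=> v; rewrite mulmxA -trmx_mul -mulmxA mxE.
by apply: sumr_ge0 => j _; rewrite mxE -expr2 sqr_ge0.
Qed.

Lemma psdmx_diag_mx (R : realFieldType) (n : nat) (r : 'rV[R]_n) :
  (forall j, 0 <= r 0 j) -> psdmx (diag_mx r).
Proof.
move=> hr v; rewrite mul_mx_diag mxE; apply: sumr_ge0 => j _; rewrite !mxE.
by rewrite mulrAC -expr2 mulr_ge0 ?sqr_ge0.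
Qed.

(** With [w = A^-1 v] one has [w^T A w = v^T (A^-1)^T v], a 1 x 1 matrix,
    which therefore equals its transpose [v^T A^-1 v].  If [A] is singular then
    [invmx A] is [A] itself. *)
Lemma psdmx_inv (R : realFieldType) (n : nat) (A : 'M[R]_n) :
  psdmx A -> psdmx (invmx A).
Proof.
move=> hA v; have [uA|nuA] := boolP (A \in unitmx); last by rewrite invmx_out.
have := hA (invmx A *m v).
rewrite -mulmxA mulKVmx // trmx_mul.
suff -> : v^T *m (invmx A)^T *m v = (v^T *m invmx A *m v)^T by rewrite mxE.
by rewrite !trmx_mul trmxK mulmxA.
Qed.

(** * Roots of the score *)

Definition score (R : realFieldType) (a d A B p q K b : R) : R :=
  a / b - d + 2^-1 * (A / (p + b * A) + B / (q + b * B)) - 2^-1 * K.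

Lemma score_decr (R : realFieldType) (a d A B p q K x y : R) :
  0 < a -> 0 < A -> 0 < B -> 0 < p -> 0 < q -> 0 < x -> x < y ->
  score a d A B p q K y < score a d A B p q K x.
Proof.
move=> ha hA hB hp hq hx hxy; have hy := lt_trans hx hxy.
have shrinks C r : 0 < C -> 0 < r -> C / (r + y * C) <= C / (r + x * C).
  move=> hC hr; rewrite ler_pM2l // lef_pV2 ?posrE.
  - by rewrite lerD2l ler_pM2r // ltW.
  - by rewrite addr_gt0 ?mulr_gt0.
  - by rewrite addr_gt0 ?mulr_gt0.
have h1 : a / y < a / x by rewrite ltr_pM2l // ltf_pV2 ?posrE.
have h2 := shrinks A p hA hp; have h3 := shrinks B q hB hq.
by rewrite /score; lra.
Qed.

Lemma score_lt0 (R : realFieldType) (c d A B p q K b : R) :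
  0 < A -> 0 < B -> 0 < p -> 0 < q -> 0 <= K -> 0 < c -> 0 < d ->
  c / d <= b -> score (c - 1) d A B p q K b < 0.
Proof.
move=> hA hB hp hq hK hc hd hb.
have hb0 : 0 < b by apply: lt_le_trans hb; rewrite divr_gt0.
have lt_inv C r : 0 < C -> 0 < r -> C / (r + b * C) < b^-1.
  move=> hC hr; rewrite ltr_pdivrMr ?addr_gt0 ?mulr_gt0 //.
  by rewrite mulrDr mulKf ?gt_eqF // ltrDr mulr_gt0 ?invr_gt0.
have hcb : c / b <= d by rewrite ler_pdivrMr // mulrC -ler_pdivrMr.
have h1 := lt_inv A p hA hp; have h2 := lt_inv B q hB hq.
by rewrite /score mulrBl mul1r; lra.
Qed.

(** Clearing denominators turns the score into a polynomial [g], which removes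
    the pole at 0: there [g] takes the positive value [a p q], and between 0
    and [t] it changes sign. *)
Lemma score_root (R : rcfType) (a d A B p q K t : R) :
  0 < a -> 0 < A -> 0 < B -> 0 < p -> 0 < q -> 0 < t ->
  score a d A B p q K t < 0 ->
  exists2 b : R, 0 < b & score a d A B p q K b = 0.
Proof.
move=> ha hA hB hp hq ht ht0.
pose P : {poly R} := p%:P + 'X * A%:P.
pose Q : {poly R} := q%:P + 'X * B%:P.
pose g : {poly R} := a%:P * P * Q - (d + 2^-1 * K)%:P * 'X * P * Q
                     + (2^-1)%:P * 'X * (A%:P * Q + B%:P * P).
have gE x : g.[x] = a * (p + x * A) * (q + x * B)
    - (d + 2^-1 * K) * x * (p + x * A) * (q + x * B)
    + 2^-1 * x * (A * (q + x * B) + B * (p + x * A)).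
  by rewrite /g /P /Q !hornerE.
have den_gt0 C r x : 0 < C -> 0 < r -> 0 < x -> 0 < r + x * C.
  by move=> hC hr hx; rewrite addr_gt0 ?mulr_gt0.
have gscore x : 0 < x ->
    g.[x] = x * (p + x * A) * (q + x * B) * score a d A B p q K x.
  move=> hx; rewrite gE /score; field.
  by rewrite !gt_eqF ?den_gt0.
have g0 : 0 < g.[0].
  by rewrite gE !mul0r !mulr0 !mul0r subr0 !addr0 !mulr_gt0.
have gt : g.[t] < 0 by rewrite gscore // pmulr_rlt0 ?mulr_gt0 ?den_gt0.
have [|b /andP[hb _]] := @poly_ivt _ (- g) 0 t (ltW ht).
  by rewrite !hornerN oppr_le0 oppr_ge0 !ltW.
rewrite rootE hornerN oppr_eq0 => /eqP gb.
have b_gt0 : 0 < b.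
  rewrite lt_neqAle hb andbT.
  by apply/eqP => b0; move: gb g0; rewrite -b0 => ->; rewrite ltxx.
exists b => //; apply/eqP; move/eqP: gb.
by rewrite gscore // mulf_eq0 gt_eqF // !mulr_gt0 ?den_gt0.
Qed.

Lemma score_unique_root (R : rcfType) (c d A B p q K : R) :
  1 < c -> 0 < d -> 0 < A -> 0 < B -> 0 < p -> 0 < q -> 0 <= K ->
  exists b : R,
    unique (fun x : R => 0 < x /\ score (c - 1) d A B p q K x = 0) b
    /\ 0 < b < c / d.
Proof.
move=> hc hd hA hB hp hq hK.
have ha : 0 < c - 1 by rewrite subr_gt0.
have hc0 : 0 < c := lt_trans ltr01 hc.
have neg b := score_lt0 hA hB hp hq hK hc0 hd (b := b).
have [b hb fb] := score_root ha hA hB hp hq (divr_gt0 hc0 hd) (neg _ (lexx _)).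
exists b; split.
  split=> // x [hx fx]; case: (ltgtP b x) => // hbx.
  - by have := score_decr d K ha hA hB hp hq hb hbx; rewrite fb fx ltxx.
  - by have := score_decr d K ha hA hB hp hq hx hbx; rewrite fb fx ltxx.
by rewrite hb ltNge; apply/negP => /neg; rewrite fb ltxx.
Qed.

(** * Signs of the precisions and of the posterior variances *)

(** The predicate [D] allows one index to be left out: nothing is known about
    the value of beta at the index of the unknown. *)
Lemma boundary_ge0 (R : realFieldType) (n : nat) (D : nat -> Prop)
    (f : nat -> R) :
  (forall j, (1 <= j <= n)%N -> D j -> 0 <= f j) -> f 0%N = 0 -> f n.+1 = 0 ->
  forall j, (j <= n.+1)%N -> D j -> 0 <= f j.
Proof.
move=> hf f0 fn [|j]; first by rewrite f0.
rewrite leq_eqVlt => /predU1P[-> _|hj]; first by rewrite fn.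
exact: hf.
Qed.

Lemma psdmx_posterior_cov (R : realType) (M N : nat) (Phi : 'M[R]_(M, N))
    (alpha beta : nat -> R) (gamma : R) :
  0 <= gamma ->
  (forall j, (j <= N.+1)%N -> 0 <= alpha j) ->
  (forall j, (j <= N)%N -> 0 <= beta j) ->
  psdmx (posterior_cov Phi alpha beta gamma).
Proof.
move=> hg ha hb; apply: psdmx_inv; apply: psdmxD.
  by apply: psdmxZ => //; exact: psdmx_gram.
apply: psdmx_diag_mx => j; rewrite mxE /prior_precision /=.
have hj := ltn_ord j.
by rewrite !addr_ge0 ?mulr_ge0 ?ha ?hb //; lia.
Qed.

Theorem theorem2 (R : realType) (M N : nat) (hN : (2 <= N)%N)
    (Phi : 'M[R]_(M, N)) (y : 'cV[R]_M)
    (* previous iterates *)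
    (alphabar betabar : nat -> R) (gammabar : R)
    (halphabar : forall j : nat, (1 <= j <= N)%N -> 0 < alphabar j)
    (halphabar0 : alphabar 0%N = 0) (halphabarN : alphabar N.+1 = 0)
    (hbetabar : forall j : nat, (1 <= j <= N.-1)%N -> 0 <= betabar j)
    (hbetabar0 : betabar 0%N = 0) (hbetabarN : betabar N = 0)
    (hgammabar : 0 < gammabar)
    (* hyperparameters and current parameters *)
    (c d : R) (hc : 1 < c) (hd : 0 < d)
    (i : nat) (hi : (1 <= i <= N.-1)%N)
    (alpha beta : nat -> R)
    (halpha : forall j : nat, (1 <= j <= N)%N -> 0 < alpha j)
    (halpha0 : alpha 0%N = 0) (halphaN : alpha N.+1 = 0)
    (hbeta : forall j : nat, (1 <= j <= N.-1)%N -> j <> i -> 0 <= beta j)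
    (hbeta0 : beta 0%N = 0) (hbetaN : beta N = 0)
    (* coordinates numbered i and i + 1 *)
    (k l : 'I_N) (hk : k.+1 = i) (hl : l.+1 = i.+1) :
  let mu := posterior_mean Phi y alphabar betabar gammabar in
  let Sigma := posterior_cov Phi alphabar betabar gammabar in
  exists b : R,
    unique (fun x : R => 0 < x /\
              stationarity_lhs c d alpha beta mu Sigma i k l x = 0) b
    /\ 0 < b < c / d.
Proof.
have N_eq : N.-1.+1 = N by lia.
move=> mu Sigma.
have Sigma_ge0 j : 0 <= Sigma j j.
  apply/psdmx_diag_ge0/psdmx_posterior_cov; first exact: ltW.
  - move=> j' hj'; apply: (boundary_ge0 (D := fun=> True)) hj' I => // j'' h _.
    exact/ltW/halphabar.
  - rewrite -{1}N_eq => j' hj'.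
    apply: (boundary_ge0 (D := fun=> True)) hj' I => //; last by rewrite N_eq.
    by move=> j'' h _; exact: hbetabar.
have alpha_ge0 j : (j <= N.+1)%N -> 0 <= alpha j.
  move=> hj; apply: (boundary_ge0 (D := fun=> True)) hj I => // j' h _.
  exact/ltW/halpha.
have beta_ge0 j : (j <= N)%N -> j <> i -> 0 <= beta j.
  rewrite -{1}N_eq.
  by apply: (boundary_ge0 (D := fun j => j <> i)); rewrite ?N_eq.
have A_gt0 : 0 < alpha i.+1 by apply: halpha; lia.
have B_gt0 : 0 < alpha i by apply: halpha; lia.
have p_gt0 : 0 < alpha i + beta i.-1 * alpha i.-1.
  by rewrite ltr_wpDr ?mulr_ge0 ?alpha_ge0 ?beta_ge0 //; lia.
have q_gt0 : 0 < alpha i.+1 + beta i.+1 * alpha i.+2.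
  by rewrite ltr_wpDr ?mulr_ge0 ?alpha_ge0 ?beta_ge0 //; lia.
have K_ge0 : 0 <= alpha i.+1 * (mu k 0 ^+ 2 + Sigma k k)
                  + alpha i * (mu l 0 ^+ 2 + Sigma l l).
  have pos2 (a m s : R) : 0 < a -> 0 <= s -> 0 <= a * (m ^+ 2 + s).
    by move=> ha hs; rewrite mulr_ge0 ?addr_ge0 ?sqr_ge0 // ltW.
  by rewrite addr_ge0 ?pos2.
have lhsE x : stationarity_lhs c d alpha beta mu Sigma i k l x =
    score (c - 1) d (alpha i.+1) (alpha i)
      (alpha i + beta i.-1 * alpha i.-1) (alpha i.+1 + beta i.+1 * alpha i.+2)
      (alpha i.+1 * (mu k 0 ^+ 2 + Sigma k k)
       + alpha i * (mu l 0 ^+ 2 + Sigma l l)) x.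
  by rewrite /stationarity_lhs /score (addrAC (alpha i.+1)).
have [b [[[b_gt0 fb] b_uniq] hb]] :=
  score_unique_root hc hd A_gt0 B_gt0 p_gt0 q_gt0 K_ge0.
exists b; split=> //; split; first by rewrite lhsE.
by move=> x [hx fx]; apply: b_uniq; rewrite -lhsE.
Qed.
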